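(* Let $\mathcal V$ be a commutative unital quantale and let $\mathbb X,\mathbb Y$ be $\mathcal V$-metagories. Then $[\mathbb X,\mathbb Y]$ (defined in the context) is a $\mathcal V$-metagory, characterized by the property that for all $\mathcal V$-metagories $\mathbb Z$, the $\mathcal V$-contractors $F:\mathbb Z\otimes\mathbb X\to\mathbb Y$ correspond bijectively to the $\mathcal V$-contractors $F^{\sharp}:\mathbb Z\to[\mathbb X,\mathbb Y]$, with the correspondence given by $$(F^{\sharp}u)(x)=F(u,x),\qquad (F^{\sharp}u)(f)=F(1_u,f),\qquad (F^{\sharp}a)_f=F(a,f),$$ for all objects $x$ and morphisms $f:x\to y$ in $\mathbb X$ and all objects $u$ and morphisms $a:u\to v$ in $\mathbb Z$.
   Context: A commutative unital quantale $\mathcal V=(\mathcal V,\leq,\otimes,\mathsf k)$ is a complete lattice with a commutative, associative binary operation $\otimes$ with neutral element $\mathsf k$ such that $u\otimes\bigvee_i v_i=\bigvee_i u\otimes v_i$ always (no relation between $\mathsf k$ and the top or bottom element is assumed). A $\mathcal V$-metagory $\mathbb X$ consists of: a class $\mathrm{ob}\,\mathbb X$ of objects; pairwise disjoint hom-sets $\mathbb X(x,y)$ of morphisms $x\to y$ (no composition is given); a distinguished morphism $1_x\in\mathbb X(x,x)$ for each object $x$; and functions $\delta=\delta_{x,y,z}:\mathbb X(x,y)\times\mathbb X(y,z)\times\mathbb X(x,z)\to\mathcal V$ such that - $\mathsf k\leq\delta(1_x,f,f)$ and $\mathsf k\leq\delta(f,1_y,f)$, - $\delta(f,g,a)\otimes\delta(g,h,b)\otimes\delta(f,b,c)\leq\delta(a,h,c)$,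 - $\delta(f,g,a)\otimes\delta(g,h,b)\otimes\delta(a,h,c)\leq\delta(f,b,c)$, for all $f:x\to y$, $g:y\to z$, $h:z\to w$, $a:x\to z$, $b:y\to w$, $c:x\to w$. A $\mathcal V$-contractor $F:\mathbb X\to\mathbb Y$ is a graph morphism (a map on objects and maps $\mathbb X(x,y)\to\mathbb Y(Fx,Fy)$) with $F(1_x)=1_{Fx}$ and $\delta_{\mathbb X}(f,g,a)\leq\delta_{\mathbb Y}(Ff,Fg,Fa)$. The tensor product $\mathbb Z\otimes\mathbb X$ has objects $\mathrm{ob}\,\mathbb Z\times\mathrm{ob}\,\mathbb X$, hom-sets $(\mathbb Z\otimes\mathbb X)((u,x),(v,y))=\mathbb Z(u,v)\times\mathbb X(x,y)$, identities $1_{(u,x)}=(1_u,1_x)$, and $\delta((a,f),(b,g),(c,h))=\delta_{\mathbb Z}(a,b,c)\otimes\delta_{\mathbb X}(f,g,h)$. A natural transformation $\alpha:F\to G$ of $\mathcal V$-contractors $F,G:\mathbb X\to\mathbb Y$ is a family of morphisms $\alpha_f:Fx\to Gy$ in $\mathbb Y$, one for every morphism $f:x\to y$ of $\mathbb X$, such that, writing $\alpha_x$ for $\alpha_{1_x}$, one has $\mathsf k\leq\delta_{\mathbb Y}(Ff,\alpha_y,\alpha_f)$ and $\mathsf k\leq\delta_{\mathbb Y}(\alpha_x,Gf,\alpha_f)$ for all $f:x\to y$. $[\mathbb X,\mathbb Y]$ has as objects the $\mathcal V$-contractors $\mathbb X\to\mathbb Y$, as morphisms $F\to G$ the natural transformations,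 identities $1_F=(Ff)_{f:x\to y}$, and $\delta_{[\mathbb X,\mathbb Y]}(\alpha,\beta,\gamma)=\bigwedge_{x\in\mathrm{ob}\,\mathbb X}\delta_{\mathbb Y}(\alpha_x,\beta_x,\gamma_x)$ for $\alpha:F\to G$, $\beta:G\to H$, $\gamma:F\to H$. (Unless $\mathbb X$ is small, $[\mathbb X,\mathbb Y]$ will in general live in a higher universe.) *)

(* Defs.v *)
From HB Require Import structures.
#[warnings="-notation-overridden"]
From mathcomp Require Import all_boot all_order.
From mathcomp Require Import monoid boolp classical_sets.
Set Implicit Arguments.
Unset Strict Implicit.
Unset Printing Implicit Defensive.
Import Order.Theory.
Local Open Scope classical_set_scope.
Local Open Scope order_scope.
Local Open Scope group_scope.

(* The tensor product of the quantale is the multiplication [*] of the monoid,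
   its neutral element k is [1]. All subsets, including the empty one, have a
   supremum, so the underlying order is a complete lattice. *)
HB.mixin Record isComQuantale (d : Order.disp_t) V
    of Order.POrder d V & Monoid V := {
  qsup : set V -> V;
  qmulC : forall u v : V, u * v = v * u;
  qsupP : forall A : set V, supremums A (qsup A);
  qmul_sup : forall (u : V) (A : set V),
    u * qsup A = qsup [set u * v | v in A]
}.

#[short(type="comQuantaleType")]
HB.structure Definition ComQuantale (d : Order.disp_t) :=
  {V of isComQuantale d V & Order.POrder d V & Monoid V}.

Definition qinf (d : Order.disp_t) (V : comQuantaleType d) (A : set V) : V :=
  qsup (lbound A).

Section QuantaleTheory.
Context {d : Order.disp_t} {V : comQuantaleType d}.
Implicit Types (u v w : V) (A : set V).

Lemma qinfP A : infimums A (qinf A).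
Proof.
have [ub lub] := qsupP (lbound A); split.
- by move=> x Ax; apply: lub => y; apply.
- by move=> y ly; apply: ub.
Qed.

Lemma qsup_pair u v : u <= v -> qsup [set u; v] = v.
Proof.
move=> uv; apply/eqP; rewrite eq_le; apply/andP; split.
- by apply: (qsupP [set u; v]).2 => x [] ->.
- by apply: (qsupP [set u; v]).1; right.
Qed.

Lemma qmul_homol u : {homo *%g u : v w / v <= w}.
Proof.
move=> v w vw; rewrite -(qsup_pair vw) qmul_sup.
by apply: (qsupP _).1; exists v => //; left.
Qed.

Lemma leq_qmul u u' v v' : u <= u' -> v <= v' -> u * v <= u' * v'.
Proof.
move=> uu' vv'; apply: (le_trans (qmul_homol u vv')).
by rewrite !(qmulC _ v') qmul_homol.
Qed.

Lemma qmul_ge1 u v : 1 <= u -> 1 <= v -> 1 <= u * v.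
Proof. by move=> u1 v1; rewrite -[1]mulg1 leq_qmul. Qed.

Lemma qmulACA u u' v v' : (u * u') * (v * v') = (u * v) * (u' * v').
Proof. by rewrite -!mulgA; congr (_ * _); rewrite !mulgA (qmulC u'). Qed.

End QuantaleTheory.

(* The data of a V-metagory, without its axioms. *)
Record premetagory (d : Order.disp_t) (V : comQuantaleType d) := Premetagory {
  ob :> Type;
  hom : ob -> ob -> Type;
  idm : forall x, hom x x;
  delta : forall x y z, hom x y -> hom y z -> hom x z -> V
}.
Arguments Premetagory {d V ob hom}.
Arguments hom {d V} X x y : rename.
Arguments idm {d V X} x : rename.
Arguments delta {d V X x y z} f g a : rename.

Record is_metagory (d : Order.disp_t) (V : comQuantaleType d)
    (X : premetagory V) : Prop := IsMetagory {
  delta1f : forall (x y : X) (f : hom X x y), 1 <= delta (idm x) f f;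
  deltaf1 : forall (x y : X) (f : hom X x y), 1 <= delta f (idm y) f;
  deltaAl : forall (x y z w : X) (f : hom X x y) (g : hom X y z)
      (h : hom X z w) (a : hom X x z) (b : hom X y w) (c : hom X x w),
    delta f g a * delta g h b * delta f b c <= delta a h c;
  deltaAr : forall (x y z w : X) (f : hom X x y) (g : hom X y z)
      (h : hom X z w) (a : hom X x z) (b : hom X y w) (c : hom X x w),
    delta f g a * delta g h b * delta a h c <= delta f b c
}.

Record metagory (d : Order.disp_t) (V : comQuantaleType d) := Metagory {
  metagory_data :> premetagory V;
  metagoryP : is_metagory metagory_data
}.

(* Morphisms with their domain and codomain. Since hom-sets are regarded as
   pairwise disjoint, [arr f = arr g] is the equality of the morphisms f and g
   when their (co)domains are not syntactically the same. *)
Definition arr (d : Order.disp_t) (V : comQuantaleType d) (X : premetagory V)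
    (x y : X) (f : hom X x y) : {xy : X * X & hom X xy.1 xy.2} :=
  existT (fun xy : X * X => hom X xy.1 xy.2) (x, y) f.

Record contractor (d : Order.disp_t) (V : comQuantaleType d)
    (X Y : premetagory V) := Contractor {
  cob :> X -> Y;
  chom : forall x y, hom X x y -> hom Y (cob x) (cob y);
  chom1 : forall x, chom (idm x) = idm (cob x);
  chom_delta : forall (x y z : X) (f : hom X x y) (g : hom X y z)
      (a : hom X x z),
    delta f g a <= delta (chom f) (chom g) (chom a)
}.
Arguments chom {d V X Y} F {x y} f : rename.

Section Contractors.
Context {d : Order.disp_t} {V : comQuantaleType d}.

Definition cid (X : premetagory V) : contractor X X :=
  {| cob := id; chom := fun _ _ => id;
     chom1 := fun=> erefl; chom_delta := fun _ _ _ _ _ _ => lexx _ |}.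

Program Definition ccomp (X Y Z : premetagory V) (G : contractor Y Z)
    (F : contractor X Y) : contractor X Z :=
  {| cob := fun x => G (F x); chom := fun _ _ f => chom G (chom F f) |}.
Next Obligation. by rewrite /= !chom1. Qed.
Next Obligation.
by apply: le_trans (chom_delta F _ _ _) (chom_delta G _ _ _).
Qed.

Definition is_iso (X Y : premetagory V) (F : contractor X Y) : Prop :=
  exists G : contractor Y X, ccomp G F = cid X /\ ccomp F G = cid Y.

End Contractors.

Section Tensor.
Context {d : Order.disp_t} {V : comQuantaleType d}.

Definition tensor_data (Z X : premetagory V) : premetagory V := {|
  ob := Z * X;
  hom := fun p q => (hom Z p.1 q.1 * hom X p.2 q.2)%type;
  idm := fun p => (idm p.1, idm p.2);
  delta := fun _ _ _ f g a => delta f.1 g.1 a.1 * delta f.2 g.2 a.2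
|}.

Lemma tensorP (Z X : metagory V) : is_metagory (tensor_data Z X).
Proof.
have [Z1 Z2 Z3 Z4] := metagoryP Z; have [X1 X2 X3 X4] := metagoryP X.
split=> * /=.
- by rewrite qmul_ge1.
- by rewrite qmul_ge1.
- by rewrite [X in X * _]qmulACA qmulACA leq_qmul.
- by rewrite [X in X * _]qmulACA qmulACA leq_qmul.
Qed.

Definition tensor (Z X : metagory V) : metagory V := Metagory (tensorP Z X).

(* K (x) X, where X also stands for its identity contractor. *)
Program Definition tensor_map (W Z : metagory V) (K : contractor W Z)
    (X : metagory V) : contractor (tensor W X) (tensor Z X) :=
  {| cob := fun p : tensor W X => (K p.1, p.2) : tensor Z X;
     chom := fun _ _ f => (chom K f.1, f.2) |}.
Next Obligation. by rewrite /= chom1. Qed.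
Next Obligation.
by apply: leq_qmul => //; exact: chom_delta.
Qed.

End Tensor.

Record nattrans (d : Order.disp_t) (V : comQuantaleType d)
    (X Y : premetagory V) (F G : contractor X Y) := Nattrans {
  nt :> forall x y, hom X x y -> hom Y (F x) (G y);
  nt_natl : forall (x y : X) (f : hom X x y),
    1 <= delta (chom F f) (nt (idm y)) (nt f);
  nt_natr : forall (x y : X) (f : hom X x y),
    1 <= delta (nt (idm x)) (chom G f) (nt f)
}.
Arguments nt {d V X Y F G} alpha {x y} f : rename.

Section FunctorMetagory.
Context {d : Order.disp_t} {V : comQuantaleType d}.

Program Definition nt_id (X Y : metagory V) (F : contractor X Y) :
  nattrans F F := {| nt := fun _ _ f => chom F f |}.
Next Obligation.
by rewrite /= chom1; apply: deltaf1 (metagoryP Y) _ _ _.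
Qed.
Next Obligation.
by rewrite /= chom1; apply: delta1f (metagoryP Y) _ _ _.
Qed.

(* [X, Y], as data only: the metagory axioms are not built in. *)
Definition funmet (X Y : metagory V) : premetagory V := {|
  ob := contractor X Y;
  hom := fun F G => nattrans F G;
  idm := fun F => nt_id F;
  delta := fun _ _ _ alpha beta gamma =>
    qinf (range (fun x : X =>
      delta (nt alpha (idm x)) (nt beta (idm x)) (nt gamma (idm x))))
|}.

(* [is_sharp F G] : G is the contractor F^sharp. *)
Definition is_sharp (X Y Z : metagory V) (F : contractor (tensor Z X) Y)
    (G : contractor Z (funmet X Y)) : Prop :=
  [/\ forall (u : Z) (x : X), (G u : contractor X Y) x = F (u, x),
      forall (u : Z) (x y : X) (f : hom X x y),
        arr (chom (G u : contractor X Y) f)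
        = arr (@chom _ _ _ _ F (u, x) (u, y) (idm u, f)) &
      forall (u v : Z) (a : hom Z u v) (x y : X) (f : hom X x y),
        arr (nt (chom G a : nattrans _ _) f)
        = arr (@chom _ _ _ _ F (u, x) (v, y) (a, f))].

End FunctorMetagory.

(* Main.v *)
Require Import Defs.
From Stdlib Require Import EqdepFacts.
#[warnings="-notation-overridden"]
From mathcomp Require Import all_boot all_order.
From mathcomp Require Import monoid boolp classical_sets.
Set Implicit Arguments.
Unset Strict Implicit.
Unset Printing Implicit Defensive.
Import Defs Order.Theory.

(** The evaluation contractor sends (alpha, f) to alpha_f. It is contractive
    because, up to delta, alpha_f beta_g = alpha_x (Gf beta_g) =
    alpha_x beta_h = gamma_h, where the auxiliary component beta_h bridges
    delta(f, g, h) and the inequality at the single object x. The remaining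
    part is Yoneda: the element of Psi_W that corresponds to the identity of W
    induces the comparison W -> [X, Y], and evaluation induces its inverse. *)

Section Extensionality.
Context {d : Order.disp_t} {V : comQuantaleType d}.

(** Equal dependent pairs have second components equal up to transport along a proof of
    [(x, y) = (x, y)], which proof irrelevance turns into [erefl]. *)
Lemma arr_inj (X : premetagory V) (x y : X) : injective (@arr d V X x y).
Proof.
by move=> f g fg; rewrite -(eq_sigT_snd fg)
  (Prop_irrelevance (eq_sigT_fst fg) erefl).
Qed.

Lemma contractor_ext (X Y : premetagory V) (F G : contractor X Y) :
    (forall x, F x = G x) ->
    (forall x y (f : hom X x y), arr (chom F f) = arr (chom G f)) ->
  F = G.
Proof.
case: F G => F0 F1 Fid Fd [G0 G1 Gid Gd] /= /funext FG; subst G0 => FG1.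
have {}FG1 : F1 = G1.
  by do 3![apply: functional_extensionality_dep => ?]; apply/arr_inj/FG1.
by subst G1; congr Contractor; exact: Prop_irrelevance.
Qed.

(** The conclusion has the shape that [contractor_ext] asks of contractors into [funmet X Y]. *)
Lemma nattrans_arr (X Y : metagory V) (F F' G G' : contractor X Y)
    (alpha : nattrans F G) (beta : nattrans F' G') :
    F = F' -> G = G' ->
    (forall x y (f : hom X x y), arr (nt alpha f) = arr (nt beta f)) ->
  @arr d V (funmet X Y) F G alpha = @arr d V (funmet X Y) F' G' beta.
Proof.
move=> FF' GG'; subst F' G'; case: alpha beta => a al ar [b bl br] /= ab.
have {}ab : a = b.
  by do 3![apply: functional_extensionality_dep => ?]; apply/arr_inj/ab.
by subst b; rewrite (Prop_irrelevance al bl) (Prop_irrelevance ar br).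
Qed.

End Extensionality.

Section FunctorMetagory.
Context {d : Order.disp_t} {V : comQuantaleType d} (X Y : metagory V).
Local Open Scope order_scope.
Local Open Scope group_scope.

Lemma le_delta_funmet (F G H : contractor X Y) (alpha : nattrans F G)
    (beta : nattrans G H) (gamma : nattrans F H) (v : V) :
  (forall x, v <= delta (nt alpha (idm x)) (nt beta (idm x))
                        (nt gamma (idm x))) ->
  v <= @delta d V (funmet X Y) F G H alpha beta gamma.
Proof. by move=> le_v; apply: (qinfP _).2 => _ [x _ <-]. Qed.

Lemma delta_funmet_le (F G H : contractor X Y) (alpha : nattrans F G)
    (beta : nattrans G H) (gamma : nattrans F H) x :
  @delta d V (funmet X Y) F G H alpha beta gamma
  <= delta (nt alpha (idm x)) (nt beta (idm x)) (nt gamma (idm x)).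
Proof. by apply: (qinfP _).1; exists x. Qed.

(** The unit laws are the naturality inequalities at [idm x]; the associativity laws are inherited
    from [Y] at each [x]. *)
Lemma funmetP : is_metagory (funmet X Y).
Proof.
split.
- by move=> F G alpha; apply: le_delta_funmet => x; exact: nt_natl.
- by move=> F G alpha; apply: le_delta_funmet => x; exact: nt_natr.
- move=> F G H K f g h a b c; apply: le_delta_funmet => x.
  apply: le_trans (deltaAl (metagoryP Y) _ _ _ _ _ _).
  by do 2?apply: leq_qmul; exact: delta_funmet_le.
- move=> F G H K f g h a b c; apply: le_delta_funmet => x.
  apply: le_trans (deltaAr (metagoryP Y) _ _ _ _ _ _).
  by do 2?apply: leq_qmul; exact: delta_funmet_le.
Qed.

(** The bundled form lets the function metagory itself be taken as [Z], as the Yoneda argument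
    requires. *)
Definition funmetagory : metagory V := Metagory funmetP.

Lemma delta_eval (F G H : contractor X Y) (alpha : nattrans F G)
    (beta : nattrans G H) (gamma : nattrans F H) x y z
    (f : hom X x y) (g : hom X y z) (h : hom X x z) :
  @delta d V (funmet X Y) F G H alpha beta gamma * delta f g h
  <= delta (nt alpha f) (nt beta g) (nt gamma h).
Proof.
have Yl := deltaAl (metagoryP Y); have Yr := deltaAr (metagoryP Y).
(* Reassociate: Gf beta_g = Gf (Gg beta_z) = (Gf Gg) beta_z = Gh beta_z = beta_h. *)
have fgh : delta f g h <= delta (chom G f) (nt beta g) (nt beta h).
  apply: le_trans (Yr _ _ _ _ _ (chom G g) (nt beta (idm z)) (chom G h) _ _).
  rewrite -[X in X <= _]mulg1 leq_qmul ?nt_natl//.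
  by rewrite -[X in X <= _]mulg1 leq_qmul ?nt_natl ?chom_delta.
(* Likewise alpha_x beta_h = (alpha_x beta_x) Hh = gamma_x Hh = gamma_h. *)
have abc : @delta d V (funmet X Y) F G H alpha beta gamma
           <= delta (nt alpha (idm x)) (nt beta h) (nt gamma h).
  apply: le_trans
    (Yr _ _ _ _ _ (nt beta (idm x)) (chom H h) (nt gamma (idm x)) _ _).
  rewrite -[X in X <= _]mulg1 leq_qmul ?nt_natr//.
  by rewrite -[X in X <= _]mulg1 leq_qmul ?nt_natr ?delta_funmet_le.
apply: le_trans
  (Yl _ _ _ _ (nt alpha (idm x)) (chom G f) _ _ (nt beta h) _).
by rewrite qmulC leq_qmul// -[X in X <= _]mul1g leq_qmul ?nt_natr.
Qed.

Section Sharp.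
Variables (Z : metagory V) (F : contractor (tensor Z X) Y).

Program Definition sharp_ob (u : Z) : contractor X Y :=
  {| cob := fun x => F (u, x);
     chom := fun x y f => @chom _ _ _ _ F (u, x) (u, y) (idm u, f) |}.
Next Obligation. exact: (chom1 F). Qed.
Next Obligation.
apply: le_trans (chom_delta F _ _ _).
by rewrite -[X in X <= _]mul1g leq_qmul// (delta1f (metagoryP Z)).
Qed.

(** Naturality comes from the unit laws: (a, f) is a composite of (1_u, f) with (a, 1_y), and of (a,
    1_x) with (1_v, f). *)
Program Definition sharp_hom (u v : Z) (a : hom Z u v) :
    nattrans (sharp_ob u) (sharp_ob v) :=
  {| nt := fun x y f => @chom _ _ _ _ F (u, x) (v, y) (a, f) |}.
Next Obligation.
apply: le_trans (chom_delta F _ _ _).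
by rewrite qmul_ge1 ?(delta1f (metagoryP Z)) ?(deltaf1 (metagoryP X)).
Qed.
Next Obligation.
apply: le_trans (chom_delta F _ _ _).
by rewrite qmul_ge1 ?(deltaf1 (metagoryP Z)) ?(delta1f (metagoryP X)).
Qed.

Program Definition sharp : contractor Z (funmet X Y) :=
  {| cob := sharp_ob : Z -> funmet X Y; chom := sharp_hom |}.
Next Obligation. exact/(@arr_inj _ _ (funmet X Y))/nattrans_arr. Qed.
Next Obligation.
apply: (qinfP _).2 => _ [t _ <-].
apply: le_trans (chom_delta F _ _ _).
by rewrite -[X in X <= _]mulg1 leq_qmul// (delta1f (metagoryP X)).
Qed.

Lemma sharpP : is_sharp F sharp.
Proof. by []. Qed.

End Sharp.

Section Flat.
Variables (Z : metagory V) (G : contractor Z (funmet X Y)).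

Program Definition flat : contractor (tensor Z X) Y :=
  {| cob := fun p : tensor Z X => (G p.1 : contractor X Y) p.2;
     chom := fun _ _ f => nt (chom G f.1 : nattrans _ _) f.2 |}.
Next Obligation. by rewrite /= (chom1 G) /= chom1. Qed.
Next Obligation.
apply: le_trans (delta_eval _ _ _ _ _ _).
by rewrite leq_qmul// (chom_delta G).
Qed.

(** The clause on [chom (G u) f] holds because [G] sends [idm u] to the identity transformation,
    whose component at [f] is [chom (G u) f]. *)
Lemma flatP : is_sharp flat G.
Proof. by split=> //= u x y f; rewrite (chom1 G). Qed.

End Flat.

Lemma is_sharp_inj (Z : metagory V) (F F' : contractor (tensor Z X) Y)
    (G : contractor Z (funmet X Y)) :
  is_sharp F G -> is_sharp F' G -> F = F'.
Proof.
move=> [F0 _ F1] [F'0 _ F'1]; apply: contractor_ext => [[u x]|].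
  by rewrite -F0.
by move=> [u x] [v y] [a f]; rewrite -F1 -F'1.
Qed.

Lemma is_sharp_unique (Z : metagory V) (F : contractor (tensor Z X) Y)
    (G G' : contractor Z (funmet X Y)) :
  is_sharp F G -> is_sharp F G' -> G = G'.
Proof.
move=> [G0 G1 G2] [G'0 G'1 G'2].
have GG' u : G u = G' u.
  by apply: contractor_ext => *; rewrite ?G0 ?G'0 ?G1 ?G'1.
apply: contractor_ext => // u v a.
by apply: nattrans_arr => // x y f; rewrite G2 G'2.
Qed.

(** This is naturality of the correspondence in [Z]. *)
Lemma is_sharp_comp (Z Z' : metagory V) (K : contractor Z' Z)
    (F : contractor (tensor Z X) Y) (G : contractor Z (funmet X Y)) :
  is_sharp F G -> is_sharp (ccomp F (tensor_map K X)) (ccomp G K).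
Proof.
move=> [G0 G1 G2]; split=> [u x|u x y f|u v a x y f] /=.
- exact: G0.
- by rewrite G1 chom1.
- exact: G2.
Qed.

Lemma sharp_bij (Z : metagory V) : bijective (@sharp Z).
Proof.
(* [is_sharp] determines each side from the other, so neither composite has to be computed. *)
exists (@flat Z) => [F|G].
  exact: is_sharp_inj (flatP _) (sharpP _).
exact: is_sharp_unique (sharpP _) (flatP _).
Qed.

End FunctorMetagory.

Section Composition.
Context {d : Order.disp_t} {V : comQuantaleType d}.

Lemma ccomp_idl (X Y : premetagory V) (F : contractor X Y) :
  ccomp (cid Y) F = F.
Proof. exact: contractor_ext. Qed.

Lemma ccomp_idr (X Y : premetagory V) (F : contractor X Y) :
  ccomp F (cid X) = F.
Proof. exact: contractor_ext. Qed.

End Composition.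

Section Representability.
Context {d : Order.disp_t} {V : comQuantaleType d} (X Y W : metagory V).
Variable Psi : forall Z : metagory V,
  contractor (tensor Z X) Y -> contractor Z W.
Hypothesis Psi_bij : forall Z : metagory V, bijective (@Psi Z).
Hypothesis Psi_nat : forall (Z Z' : metagory V) (K : contractor Z' Z)
    (F : contractor (tensor Z X) Y),
  Psi (ccomp F (tensor_map K X)) = ccomp (Psi F) K.

Lemma comparison :
  exists! I : contractor W (funmet X Y),
    is_iso I /\
    forall (Z : metagory V) (F : contractor (tensor Z X) Y),
      is_sharp F (ccomp I (Psi F)).
Proof.
have [U PsiU] : exists U, @Psi W U = cid W.
  by have [g _ gK] := Psi_bij W; exists (g (cid W)).
(* [U] is the universal element: by naturality, both sides have image [Psi F]. *)
have Psi_ex (Z : metagory V) (F : contractor (tensor Z X) Y) :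
    F = ccomp U (tensor_map (Psi F) X).
  by apply: (bij_inj (Psi_bij Z)); rewrite Psi_nat PsiU ccomp_idl.
have compat (Z : metagory V) (F : contractor (tensor Z X) Y) :
    is_sharp F (ccomp (sharp U) (Psi F)).
  by rewrite {1}[F]Psi_ex; exact/is_sharp_comp/sharpP.
pose ev := @flat _ _ X Y (funmetagory X Y) (cid _).
exists (sharp U); split; last first.
  (* Testing compatibility at [U] forces [I] to be [sharp U]. *)
  move=> I [_ /(_ W U)]; rewrite PsiU ccomp_idr.
  exact: is_sharp_unique (sharpP U).
split=> //; exists (@Psi (funmetagory X Y) ev); split.
  (* It suffices that [ev] precomposed with [tensor_map (sharp U) X] is [U]; both correspond to
     [sharp U]. *)
  rewrite -(@Psi_nat (funmetagory X Y)) -PsiU; congr Psi.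
  apply: is_sharp_inj (sharpP U).
  rewrite -[sharp U]ccomp_idl.
  exact: (@is_sharp_comp _ _ _ _ (funmetagory X Y)) (flatP _).
(* The other composite and the identity both correspond to [ev]. *)
exact: is_sharp_unique (compat _ ev) (flatP _).
Qed.

End Representability.

Theorem theorem4p2 (d : Order.disp_t) (V : comQuantaleType d)
    (X Y : metagory V) :
  [/\ is_metagory (funmet X Y),
      forall Z : metagory V,
        exists sharp : contractor (tensor Z X) Y -> contractor Z (funmet X Y),
          bijective sharp /\ forall F, is_sharp F (sharp F) &
      (* any W with such a natural correspondence is isomorphic to [X, Y] by a
         unique isomorphism that is compatible with the correspondences *)
      forall (W : metagory V)
        (Psi : forall Z : metagory V,
          contractor (tensor Z X) Y -> contractor Z W),
        (forall Z : metagory V, bijective (Psi Z)) ->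
        (forall (Z Z' : metagory V) (K : contractor Z' Z)
            (F : contractor (tensor Z X) Y),
          Psi Z' (ccomp F (tensor_map K X)) = ccomp (Psi Z F) K) ->
        exists! I : contractor W (funmet X Y),
          is_iso I /\
          forall (Z : metagory V) (F : contractor (tensor Z X) Y),
            is_sharp F (ccomp I (Psi Z F))].
Proof.
split.
- exact: funmetP.
- by move=> Z; exists (@sharp _ _ X Y Z); split; [exact: sharp_bij|exact: sharpP].
- by move=> W Psi Psi_bij Psi_nat; exact: comparison.
Qed.
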